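(* If $m$ is odd and $m>1$, then $[x^m]\left(\frac{x}{\log(1+x)}\right)^m=0$. If $m$ is even and $m>0$, then $[x^{m+1}]\left(\frac{x}{\log(1+x)}\right)^m=0$.
   Context: $\frac{x}{\log(1+x)}$ denotes the formal power series reciprocal to $\log(1+x)/x=\sum_{i\ge0}(-1)^i\frac{x^i}{i+1}$. For a power series $f(x)$, $[x^n]f(x)$ denotes the coefficient of $x^n$. *)

(* Defs.v *)
From mathcomp Require Import all_boot all_order all_algebra.

Set Implicit Arguments.
Unset Strict Implicit.
Unset Printing Implicit Defensive.

Import GRing.Theory.

Local Open Scope ring_scope.

(* Formal power series over R, as coefficient sequences: the coefficient
   [x^n] f is f n. *)
Definition fps (R : Type) := nat -> R.

Section FormalPowerSeries.

Variable R : fieldType.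
Implicit Types f g : fps R.

Definition fps_one : fps R := fun n => (n == 0%N)%:R.

Definition fps_mul f g : fps R := fun n => \sum_(i < n.+1) f i * g (n - i)%N.

Definition fps_exp f (k : nat) : fps R := iter k (fps_mul f) fps_one.

(* The first n coefficients of the reciprocal g of f, obtained by solving
   \sum_(i <= k) f i * g (k - i) = (k == 0) for g k successively. *)
Fixpoint fps_inv_seq f (n : nat) : seq R :=
  if n is k.+1 then
    let s := fps_inv_seq f k in
    rcons s ((f 0%N)^-1 *
             (fps_one k - \sum_(i < k) f i.+1 * nth 0 s (k - i.+1)%N))
  else [::].

(* The reciprocal of f; meaningful when f 0 != 0 (see fps_mulfV). *)
Definition fps_inv f : fps R := fun n => nth 0 (fps_inv_seq f n.+1) n.

Lemma size_fps_inv_seq f n : size (fps_inv_seq f n) = n.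
Proof. by elim: n => //= n IHn; rewrite size_rcons IHn. Qed.

Lemma nth_fps_inv_seq f n i :
  (i < n)%N -> nth 0 (fps_inv_seq f n) i = fps_inv f i.
Proof.
elim: n => // n IHn; rewrite ltnS leq_eqVlt => /predU1P[-> //|lt_in].
by rewrite /= nth_rcons size_fps_inv_seq lt_in IHn.
Qed.

Lemma fps_mulfV f : f 0%N != 0 -> fps_mul f (fps_inv f) =1 fps_one.
Proof.
move=> f0 n; rewrite /fps_mul big_ord_recl subn0 {1}/fps_inv /=.
rewrite nth_rcons size_fps_inv_seq ltnn eqxx mulVKf //.
set s := fps_inv_seq f n.
rewrite -[RHS](subrK (\sum_(i < n) f i.+1 * nth 0 s (n - i.+1)%N)).
congr (_ + _); apply: eq_bigr => i _.
by rewrite /= nth_fps_inv_seq // ltn_subrL (leq_ltn_trans _ (ltn_ord i)).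
Qed.

End FormalPowerSeries.

Arguments fps_one {R}.

(* The series log(1+x)/x and its reciprocal x/log(1+x). *)
Definition log1p_div_x : fps rat := fun i => (-1) ^+ i / (i.+1)%:R.

Definition x_div_log1p : fps rat := fps_inv log1p_div_x.

Lemma x_div_log1pP : fps_mul log1p_div_x x_div_log1p =1 fps_one.
Proof. by apply: fps_mulfV. Qed.

(* Main.v *)
(** Put [F = x / log (1 + x)] and [f_(m,n) = [x^n] F^m].  The involution
    [s = - x / (1 + x)] satisfies [log (1 + s) = - log (1 + x)], whence
    [F (s) = F / (1 + x)], that is [F^m = (1 + x)^m F^m (s)].  Extracting
    the coefficient of [x^m] gives [f_(m,m) = \sum_(k <= m) (-1)^k f_(m,k)].
    On the other hand [F^2 = (1 + x) (F - x F')] gives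
    [m f_(m+1,n) = (m-n) f_(m,n) + (m-n+1) f_(m,n-1)], so that
    [\sum_(k < m) (-1)^k f_(m,k)] telescopes to [0] when [m > 1].  Hence
    [f_(m,m) = (-1)^m f_(m,m)], which settles odd [m]; the recurrence at
    [n = m + 1] reduces even [m] to [f_(m+1,m+1) = 0].
    All series are handled as polynomials modulo a power of [x]. *)

Require Import Defs.
From mathcomp Require Import all_boot all_order all_algebra.
From mathcomp Require Import ring lra.

Set Implicit Arguments.
Unset Strict Implicit.
Unset Printing Implicit Defensive.

Import GRing.Theory Num.Theory.
Local Open Scope ring_scope.

(** * Congruence of polynomials modulo a power of X *)

Definition eqmodX {R : comNzRingType} (N : nat) (p q : {poly R}) : Prop :=
  exists r, p = q + 'X^N * r.

Section EqmodX.

Variables (R : comNzRingType) (N : nat).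
Implicit Types p q : {poly R}.

Lemma eqmodXM p1 q1 p2 q2 :
  eqmodX N p1 q1 -> eqmodX N p2 q2 -> eqmodX N (p1 * p2) (q1 * q2).
Proof.
move=> [a ->] [b ->]; exists (q1 * b + a * q2 + 'X^N * a * b).
by move: ('X^N) => y; ring.
Qed.

Lemma eqmodX_exp p q k : eqmodX N p q -> eqmodX N (p ^+ k) (q ^+ k).
Proof.
move=> pq; elim: k => [|k IHk]; first by exists 0; rewrite mulr0 addr0.
by rewrite !exprS; apply: eqmodXM.
Qed.

Lemma eqmodX_coef p q i : (i < N)%N -> eqmodX N p q -> p`_i = q`_i.
Proof. by move=> iN [a ->]; rewrite coefD coefXnM iN addr0. Qed.

Lemma coef_eqmodX p q : (forall i, (i < N)%N -> p`_i = q`_i) -> eqmodX N p q.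
Proof.
move=> pq; exists (drop_poly N p - drop_poly N q).
rewrite -{1}(poly_take_drop N p) -{1}(poly_take_drop N q).
have -> : take_poly N p = take_poly N q.
  by apply/polyP=> i; rewrite !coef_take_poly; case: ifP => // /pq.
by rewrite mulrBr -![_ * 'X^N]mulrC; ring.
Qed.

End EqmodX.

Lemma fps_exp_poly (R : fieldType) (f : fps R) (N k n : nat) : (n < N)%N ->
  fps_exp f k n = ((\poly_(i < N) f i) ^+ k)`_n.
Proof.
elim: k n => [|k IHk] n nN; first by rewrite expr0 coef1.
rewrite exprS coefM; apply: eq_bigr => i _.
rewrite coef_poly (leq_ltn_trans _ nN) -1?ltnS // -IHk //.
exact: leq_ltn_trans (leq_subr _ _) nN.
Qed.

(** * The involution and the differential equation, for truncated series *)

Section TruncatedLog.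

Variable N : nat.

Let ell : {poly rat} := \poly_(i < N.+1) log1p_div_x i.
Let F : {poly rat} := \poly_(i < N.+1) x_div_log1p i.
(** [v] truncates 1/(1+x), so [s] truncates the involution -x/(1+x). *)
Let v : {poly rat} := \poly_(i < N.+1) (-1) ^+ i.
Let s : {poly rat} := - ('X * v).

Let mul_ell_F : eqmodX N.+1 (ell * F) 1.
Proof.
apply: coef_eqmodX => n nN; rewrite coef1 -[RHS]x_div_log1pP coefM.
apply: eq_bigr => i _; rewrite !coef_poly.
by rewrite (leq_trans (ltn_ord i) nN) (leq_ltn_trans (leq_subr _ _) nN).
Qed.

Let v_inv : eqmodX N.+1 ((1 + 'X) * v) 1.
Proof.
exists (- (-1) ^+ N.+1).
have -> : v = \sum_(i < N.+1) (- 'X) ^+ i.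
  rewrite /v poly_def; apply: eq_bigr => i _.
  by rewrite [RHS]exprNn -mul_polyC polyC_exp polyCN.
have -> : 1 + 'X^(N.+1) * - (-1) ^+ N.+1 = 1 - (- 'X) ^+ N.+1 :> {poly rat}.
  by rewrite [in RHS]exprNn mulrN [_ * 'X^_]mulrC.
by rewrite -[1 - _]opprB subrX1; ring.
Qed.

Let deriv_Xell : ('X * ell)^`() = v.
Proof.
apply/polyP=> i; rewrite coef_deriv coefXM /= !coef_poly.
case: ifP => // _; last by rewrite mul0rn.
by rewrite /log1p_div_x -[LHS]mulr_natr mulfVK // pnatr_eq0.
Qed.

(** Since X divides [s], substituting [s] preserves congruences modulo powers of X. *)
Let comp_s_Xn p k : exists r, ('X^k * p) \Po s = 'X^k * r.
Proof.
exists ((- v) ^+ k * (p \Po s)).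
by rewrite comp_polyM comp_Xn_poly mulrA -exprMn /s mulrN.
Qed.

(** Substituting [s] in (1+X)v = 1 gives (1+s) v(s) = 1, while (1+X)(1+s) = 1, both modulo
    X^(N+1). *)
Let v_s : eqmodX N.+1 (v \Po s) (1 + 'X).
Proof.
have [a va] := v_inv.
have [b Eb] := comp_s_Xn a N.+1.
have : ((1 + 'X) * v) \Po s = 1 + (('X^(N.+1) * a) \Po s).
  by rewrite va comp_polyD comp_polyC.
rewrite Eb comp_polyM comp_polyD comp_polyC comp_polyX => H.
set w := v \Po s in H *.
exists ('X * a * w + (1 + 'X) * b); move: ('X^(N.+1)) va H => y va H.
transitivity ((1 + 'X) * ((1 + s) * w) + 'X * ((1 + 'X) * v - 1) * w).
  by rewrite /s; ring.
by rewrite H va; ring.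
Qed.

(** The derivative vanishes modulo X^(N+1), and so does the constant term; in characteristic 0 this
    gives precision N+2, one more than needed, because [ell_s] divides by X. *)
Let log_s : eqmodX N.+2 ('X * ell + (('X * ell) \Po s)) 0.
Proof.
have [a va] := v_inv; have [r vsr] := v_s.
(* Differentiating (1+X)v = 1 costs one power of X; the factor X restores it. *)
have vd : 'X * (v + (1 + 'X) * v^`()) = 'X^(N.+1) * (a *+ N.+1 + 'X * a^`()).
  have := congr1 (fun p => 'X * p^`()) va.
  rewrite !derivM !derivD derivM derivXn derivX -[1]/(1%:P) derivC /= => H.
  transitivity ('X * ((0 + 1) * v + (1%:P + 'X) * v^`())).
    by rewrite add0r mul1r.
  by rewrite H !exprS; ring.
have D : ('X * ell + (('X * ell) \Po s))^`()
    = 'X^(N.+1) * (r * s^`() - (a *+ N.+1 + 'X * a^`())).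
  rewrite derivD deriv_comp deriv_Xell vsr.
  have -> : s^`() = - (v + 'X * v^`()).
    by rewrite /s derivN derivM derivX mul1r.
  move: ('X^(N.+1)) vd => y vd.
  transitivity (v - (1 + 'X) * v - 'X * (1 + 'X) * v^`()
    + y * r * - (v + 'X * v^`())); first by ring.
  transitivity (- ('X * (v + (1 + 'X) * v^`())) + y * r * - (v + 'X * v^`())).
    by ring.
  by rewrite vd; ring.
apply: coef_eqmodX => -[_|i iN]; rewrite coef0.
  by rewrite -horner_coef0 hornerD horner_comp /s !hornerE.
have := congr1 (fun p : {poly rat} => p`_i) D.
rewrite coef_deriv coefXnM -ltnS iN => /eqP.
by rewrite mulrn_eq0 => /eqP.
Qed.

Let ell_s : eqmodX N.+1 (ell \Po s) ((1 + 'X) * ell).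
Proof.
have [a va] := v_inv; have [t] := log_s.
rewrite comp_polyM comp_polyX add0r exprS -mulrA => /eqP.
rewrite /s mulNr -mulrA -mulrBr => /eqP /(mulfI (negbT (polyX_eq0 _))).
set w := ell \Po _ => H.
exists (- (a * w) - (1 + 'X) * t); move: ('X^(N.+1)) va H => y va H.
transitivity ((1 + 'X) * ell - (1 + 'X) * (ell - v * w)
   - ((1 + 'X) * v - 1) * w); first by ring.
by rewrite H va; ring.
Qed.

(** Substituting [s] in ell F = 1 gives (1+X) ell F(s) = 1; multiply by F. *)
Let F_s : eqmodX N.+1 ((1 + 'X) * (F \Po s)) F.
Proof.
have [b Fb] := mul_ell_F; have [c ec] := ell_s.
have [b' Eb] := comp_s_Xn b N.+1.
have := congr1 (comp_poly s) Fb.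
rewrite comp_polyD Eb comp_polyM comp_polyC ec => H.
set w := F \Po s in H *.
exists (F * b' - F * w * c - (1 + 'X) * w * b).
move: ('X^(N.+1)) Fb H => y Fb H.
transitivity (F * (((1 + 'X) * ell + y * c) * w) - y * F * w * c
  - (1 + 'X) * w * (ell * F - 1)); first by ring.
by rewrite H Fb; ring.
Qed.

(** Differentiate X ell F = X, using (X ell)' = v, then multiply by (1+X)F. *)
Lemma x_div_log1p_riccati :
  eqmodX N.+1 (F ^+ 2) ((1 + 'X) * (F - 'X * F^`())).
Proof.
have [a va] := v_inv; have [b Fb] := mul_ell_F.
have H : v * F + 'X * ell * F^`() = 1 + 'X^(N.+1) * (b *+ N.+2 + 'X * b^`()).
  rewrite -deriv_Xell -derivM -mulrA Fb mulrDr mulr1 mulrA -exprS.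
  by rewrite derivD derivX derivM derivXn !exprS; ring.
exists ((1 + 'X) * F * (b *+ N.+2 + 'X * b^`()) - a * F ^+ 2
   - 'X * b * (1 + 'X) * F^`()).
move: ('X^(N.+1)) va Fb H => y va Fb H.
transitivity ((1 + 'X) * F * (v * F + 'X * ell * F^`())
  - ((1 + 'X) * v - 1) * F ^+ 2 - 'X * (ell * F) * (1 + 'X) * F^`()).
  by ring.
by rewrite H va Fb; ring.
Qed.

(** The previous congruence times (m+1) F^m, as (F^(m+1))' = (m+1) F^m F'. *)
Lemma x_div_log1p_exp_rec (m : nat) :
  eqmodX N.+1 (F ^+ m.+2 *+ m.+1)
    ((1 + 'X) * (F ^+ m.+1 *+ m.+1 - 'X * (F ^+ m.+1)^`())).
Proof.
have [r Fr] := x_div_log1p_riccati; exists (r * F ^+ m *+ m.+1).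
have -> : F ^+ m.+2 = F ^+ 2 * F ^+ m by rewrite -exprD.
rewrite deriv_exp Fr (exprS F m) /=.
by move: ('X^(N.+1)) (F ^+ m) => y p; ring.
Qed.

Lemma coef_x_div_log1p_exp_involution (m : nat) : (m <= N)%N ->
  (F ^+ m)`_m = \sum_(k < m.+1) (-1) ^+ k * (F ^+ m)`_k.
Proof.
move=> mN; have := eqmodX_exp m F_s; set G := F ^+ m.
have -> : ((1 + 'X) * (F \Po s)) ^+ m = (1 + 'X) ^+ m * (G \Po s).
  by rewrite exprMn /G (rmorphXn (comp_poly s)).
move=> /(eqmodX_coef (i := m)) <-; last by rewrite ltnS.
(* Terms of [G] of degree above m stay divisible by X^(m+1) after substituting [s]. *)
rewrite -{1}(poly_take_drop m.+1 G) comp_polyD mulrDr coefD.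
rewrite [drop_poly _ _ * _]mulrC.
have [r ->] := comp_s_Xn (drop_poly m.+1 G) m.+1.
rewrite mulrCA coefXnM ltnSn addr0 /take_poly poly_def linear_sum mulr_sumr.
rewrite coef_sum; apply: eq_bigr => k _ /=.
rewrite comp_polyZ comp_Xn_poly -scalerAr coefZ mulrC; congr (_ * _).
have km : (k <= m)%N by rewrite -ltnS.
(* (1+X)^m s^k = (1+X)^(m-k) ((1+X)s)^k, where (1+X)s is congruent to -X. *)
rewrite -{1}(subnK km) exprD -mulrA -exprMn.
have /(eqmodX_exp k) [t ->] : eqmodX N.+1 ((1 + 'X) * s) (- 'X).
  have [a va] := v_inv; exists (- 'X * a); rewrite /s.
  by move: ('X^(N.+1)) va => y va; rewrite mulrN mulrCA va; ring.
rewrite mulrDr coefD [X in _ + X](_ : _ = 0); last first.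
  by rewrite mulrCA coefXnM ltnS mN.
rewrite addr0 [(- 'X) ^+ k]exprNn mulrCA -polyCN -polyC_exp coefCM.
rewrite coefMXn ltnNge km /=.
(* What remains is the leading coefficient of the monic (1+X)^(m-k). *)
have -> : 1 + 'X = 'X - (-1)%:P :> {poly rat} by rewrite polyCN opprK addrC.
have := monic_exp (m - k) (monicXsubC (-1 : rat)).
by rewrite monicE /lead_coef size_exp_XsubC /= => /eqP ->; rewrite mulr1.
Qed.

End TruncatedLog.

(** * Coefficients of the powers *)

Local Notation f m n := (fps_exp x_div_log1p m n).

Local Arguments fps_exp : simpl never.

Lemma fps_exp_x_div_log1p0 (m : nat) : f m 0 = 1.
Proof.
elim: m => [|m IHm] //; transitivity (x_div_log1p 0%N * f m 0).
  exact: big_ord1.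
by rewrite IHm mulr1 /x_div_log1p /fps_inv /= big_ord0 subr0 divff.
Qed.

Lemma fps_exp_x_div_log1p_rec (m n : nat) :
  m.+1%:R * f m.+2 n.+1 =
    (m.+1%:R - n.+1%:R) * f m.+1 n.+1 + (m.+1%:R - n%:R) * f m.+1 n.
Proof.
rewrite !(@fps_exp_poly _ _ n.+2) //.
have := eqmodX_coef (ltnSn n.+1) (x_div_log1p_exp_rec n.+1 m).
rewrite coefMn mulr_natl => ->.
set G := _ ^+ m.+1; rewrite mulrDl mul1r coefD coefXM /= !coefB !coefMn.
rewrite !coefXM /=; case: n @G => [|n] G.
  by rewrite coef_deriv /=; ring.
by rewrite /= !coef_deriv; ring.
Qed.

(** The recurrence makes the sum telescope; the factor m+1-j kills it at j = m+1. *)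
Lemma alt_sum_fps_exp_x_div_log1p (m j : nat) :
  m.+1%:R * (\sum_(k < j.+1) (-1) ^+ k * f m.+2 k) =
    (-1) ^+ j * (m.+1%:R - j%:R) * f m.+1 j.
Proof.
elim: j => [|j IHj].
  by rewrite big_ord1 !fps_exp_x_div_log1p0 !expr0; ring.
rewrite big_ord_recr mulrDr {}IHj /= [X in _ + X]mulrCA.
by rewrite fps_exp_x_div_log1p_rec exprS; ring.
Qed.

Lemma fps_exp_x_div_log1p_odd (m : nat) : odd m -> (1 < m)%N -> f m m = 0.
Proof.
case: m => [|[|m]] // m_odd _.
have := @coef_x_div_log1p_exp_involution m.+2 m.+2 (leqnn _).
under eq_bigr => k _ do rewrite -fps_exp_poly //.
rewrite -fps_exp_poly // big_ord_recr /= -signr_odd m_odd expr1.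
have /eqP := alt_sum_fps_exp_x_div_log1p m m.+1.
rewrite subrr mulr0 mul0r mulf_eq0 pnatr_eq0 /= => /eqP ->.
by lra.
Qed.

Theorem theorem2p1 (m : nat) :
  (odd m -> (1 < m)%N -> fps_exp x_div_log1p m m = 0) /\
  (~~ odd m -> (0 < m)%N -> fps_exp x_div_log1p m m.+1 = 0).
Proof.
split; first exact: fps_exp_x_div_log1p_odd.
case: m => // m m_even _.
(* The exponent is now m+1: the two coefficients on the right are -1 and 0, and the left side
   vanishes by the odd case m+2. *)
have := fps_exp_x_div_log1p_rec m m.+1.
rewrite fps_exp_x_div_log1p_odd // mulr0 subrr mul0r addr0 -[m.+2%:R]natr1.
by rewrite opprD addNKr mulN1r => /eqP; rewrite eq_sym oppr_eq0 => /eqP.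
Qed.
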